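(* Let $k\ge 2$ be an integer, let $n_1>n_2>\cdots>n_{k-1}>0$ be integers, let $a_1,\dots,a_k\in\mathbb{C}$ (some of which may be $0$), and suppose that $$f(z)=a_1z^{n_1}+\cdots+a_{k-1}z^{n_{k-1}}+a_k\in\mathbb{C}[z]$$ is a nonzero polynomial. Then $$M(f)\ \ge\ \frac{h(f)}{2^{k-2}}.$$
   Context: For a nonzero polynomial $f\in\mathbb{C}[z]$, the logarithmic Mahler measure is $m(f)=\int_0^1\log|f(e^{2\pi i t})|\,dt$ and the Mahler measure is $M(f)=\exp(m(f))$. The height $h(f)$ is the maximum modulus of the coefficients of $f$. *)

(* Defs.v *)
From HB Require Import structures.
From mathcomp Require Import all_boot all_order all_algebra.
From mathcomp Require Import all_classical all_reals all_analysis.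
From mathcomp Require Import complex.

Set Implicit Arguments.
Unset Strict Implicit.
Unset Printing Implicit Defensive.

Import Order.TTheory GRing.Theory Num.Theory.
Import numFieldNormedType.Exports.

Local Open Scope classical_set_scope.
Local Open Scope ring_scope.
Local Open Scope complex_scope.

(* [`|z|] on R[i] takes its values in R[i]; the modulus is wanted in R. *)
Definition modulus (R : realType) (z : R[i]) : R := complex.Re `|z|.

Definition unit_circle_point (R : realType) (t : R) : R[i] :=
  cos (2 * pi * t) +i* sin (2 * pi * t).

(* For f != 0 the integrand has at most finitely many singularities, all
   logarithmic, hence is Lebesgue integrable; the library's convention ln 0 = 0
   only affects these finitely many points. *)
Definition log_mahler (R : realType) (f : {poly R[i]}) : R :=
  \int[@lebesgue_measure R]_(t in `[0, 1]) ln (modulus f.[unit_circle_point t]).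

Definition mahler (R : realType) (f : {poly R[i]}) : R := expR (log_mahler f).

Definition height (R : realType) (f : {poly R[i]}) : R :=
  \big[Num.max/0]_(i < size f) modulus f`_i.

(* Main.v *)
(* With Ma(f) the modulus of the leading coefficient times the product of
   max(1, |root|), the theorem follows from three facts.
   (1) Ma(f) <= M(f), by Jensen's formula on circles |z| = r > 1, r -> 1.
   (2) Mahler's inequality Ma(f') <= deg(f) Ma(f): reflect the roots of f lying
   outside the unit disk to get g with the roots in the disk, |f| <= |g| for
   |z| > 1 and lead(g) of modulus Ma(f); by Gauss-Lucas |f'| <= |g'| for |z| > 1,
   and Jensen's formula gives Ma(f') <= |lead(g')| = deg(f) |lead(g)|.
   (3) Assume f(0) != 0 and n = deg f. Differentiating removes the constant term
   and multiplies the coefficient a_j by j, so if j >= n/2, (2) bounds |a_j| with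
   a loss of a factor 2 by induction on the number of monomials; if j < n/2, first
   reverse f, which preserves Ma. Two monomials are handled by
   Ma(f) >= max(|f(0)|, |lead f|). *)
Require Import Defs.
From HB Require Import structures.
From mathcomp Require Import all_boot all_order all_algebra.
From mathcomp Require Import all_classical all_reals all_analysis.
From mathcomp Require Import complex.
From mathcomp Require Import measurable_realfun.
From mathcomp Require Import ring lra zify.

Import Order.TTheory GRing.Theory Num.Theory.

Local Open Scope ring_scope.

(** * The real-valued modulus on [R[i]] *)

Section Modulus.
Context {R : realType}.
Implicit Types z w : R[i].

Lemma normc_modulus z : `|z| = (modulus z)%:C%C.
Proof. by rewrite /modulus normc_def. Qed.

Lemma sqr_modulus z : modulus z ^+ 2 = complex.Re z ^+ 2 + complex.Im z ^+ 2.
Proof. by rewrite /modulus normc_def /= sqr_sqrtr// addr_ge0// sqr_ge0. Qed.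

Lemma modulusE (x y : R) : modulus (x +i* y)%C = Num.sqrt (x ^+ 2 + y ^+ 2).
Proof. by rewrite /modulus normc_def. Qed.

Lemma modulus_ge0 z : 0 <= modulus z.
Proof. by rewrite /modulus normc_def /= sqrtr_ge0. Qed.

Lemma modulusM z w : modulus (z * w) = modulus z * modulus w.
Proof. by apply: complexI; rewrite -normc_modulus normrM !normc_modulus rmorphM. Qed.

Lemma modulusV z : modulus z^-1 = (modulus z)^-1.
Proof. by apply: complexI; rewrite -normc_modulus normfV !normc_modulus fmorphV. Qed.

Lemma modulusD z w : modulus (z + w) <= modulus z + modulus w.
Proof. by rewrite -lecR rmorphD /= -!normc_modulus ler_normD. Qed.

Lemma modulusN z : modulus (- z) = modulus z.
Proof. by rewrite /modulus normrN. Qed.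

Lemma modulus_eq0 z : (modulus z == 0) = (z == 0).
Proof. by rewrite -(inj_eq (@complexI R)) -normc_modulus normr_eq0. Qed.

Lemma modulus0 : modulus (0 : R[i]) = 0.
Proof. by apply/eqP; rewrite modulus_eq0. Qed.

Lemma modulus_gt0 z : (0 < modulus z) = (z != 0).
Proof. by rewrite lt_neqAle modulus_ge0 andbT eq_sym modulus_eq0. Qed.

Lemma modulus_real (x : R) : 0 <= x -> modulus x%:C%C = x.
Proof.
by move=> x0; apply: complexI; rewrite -normc_modulus ger0_norm ?ler0c.
Qed.

Lemma modulus1 : modulus (1 : R[i]) = 1.
Proof. by rewrite -[1 in LHS]/(1%:C)%C modulus_real. Qed.

Lemma modulus_nat n : modulus (n%:R : R[i]) = n%:R.
Proof. by rewrite -(rmorph_nat (real_complex R)) modulus_real. Qed.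

Lemma modulusJ z : modulus (conjc z) = modulus z.
Proof. by rewrite /modulus normcJ. Qed.

Lemma modulus_prod (I : Type) (r : seq I) (F : I -> R[i]) :
  modulus (\prod_(i <- r) F i) = \prod_(i <- r) modulus (F i).
Proof. exact: (big_morph _ modulusM modulus1). Qed.

Lemma modulusX z n : modulus (z ^+ n) = modulus z ^+ n.
Proof. by elim: n => [|n IH]; rewrite ?modulus1// !exprS modulusM IH. Qed.

Lemma modulus_sum (I : Type) (r : seq I) (F : I -> R[i]) :
  modulus (\sum_(i <- r) F i) <= \sum_(i <- r) modulus (F i).
Proof.
elim/big_rec2: _ => [|i x z _ IH]; first by rewrite modulus0.
by rewrite (le_trans (modulusD _ _))// lerD2l.
Qed.

End Modulus.

(** * Gauss-Lucas for disks centred at the origin *)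

Section Derivative.
Context {R : realType}.
Implicit Types (z w : R[i]) (s : seq R[i]) (p q : {poly R[i]}).

Definition poly_of_roots s : {poly R[i]} := \prod_(a <- s) ('X - a%:P).

Lemma poly_of_roots_cons a s : poly_of_roots (a :: s) = ('X - a%:P) * poly_of_roots s.
Proof. by rewrite /poly_of_roots big_cons. Qed.

Lemma horner_poly_of_roots s z : (poly_of_roots s).[z] = \prod_(a <- s) (z - a).
Proof. by rewrite horner_prod; apply: eq_bigr => a _; rewrite hornerXsubC. Qed.

Lemma poly_of_roots_neq0 s z :
  (forall a, a \in s -> modulus a < modulus z) -> (poly_of_roots s).[z] != 0.
Proof.
move=> sz; rewrite horner_poly_of_roots prodf_seq_neq0; apply/allP => a /sz az.
by apply: contraTneq az => /subr0_eq ->; rewrite ltxx.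
Qed.

Lemma size_poly_of_roots s : size (poly_of_roots s) = (size s).+1.
Proof. exact: size_prod_XsubC. Qed.

(** The real part is Re(z conj(z - a)) / |z - a|^2, and 2 Re(z conj(z - a)) = |z|^2 - |a|^2 + |z -
    a|^2. *)
Lemma Re_div_sub_gt0 z a : modulus a < modulus z -> 0 < complex.Re (z / (z - a)).
Proof.
move=> az; have := az; rewrite -(ltr_pXn2r (_ : 0 < 2)%N) ?nnegrE ?modulus_ge0//.
have : z - a != 0 by apply: contraTneq az => /subr0_eq ->; rewrite ltxx.
rewrite !sqr_modulus -modulus_gt0 => nz0.
have {nz0} : 0 < modulus (z - a) ^+ 2 by rewrite exprn_gt0.
rewrite sqr_modulus; case: z az => x y _; case: a => a b /=.
set d := _ + _ => d0 lt.
rewrite (_ : _ - _ = (x * (x - a) + y * (y - b)) / d); last by ring.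
apply: divr_gt0 => //.
have := sqr_ge0 (x - a); have := sqr_ge0 (y - b); rewrite !expr2 in lt *; lra.
Qed.

(** This is the logarithmic derivative; the factor [z] puts the summands in the form of
    [Re_div_sub_gt0]. *)
Lemma deriv_poly_of_roots s z : (forall a, a \in s -> modulus a < modulus z) ->
  z * (poly_of_roots s)^`().[z] = (poly_of_roots s).[z] * \sum_(a <- s) z / (z - a).
Proof.
elim: s => [|a s IH] sz.
  by rewrite /poly_of_roots !big_nil derivC horner0 !mulr0.
have za : z - a != 0.
  apply/eqP => /subr0_eq za; have := sz a (mem_head _ _); by rewrite za ltxx.
have {}IH : z * (poly_of_roots s)^`().[z] = (poly_of_roots s).[z] * \sum_(a <- s) z / (z - a).
  by apply: IH => b bs; apply: sz; rewrite inE bs orbT.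
rewrite poly_of_roots_cons derivM derivXsubC mul1r big_cons hornerD !hornerM hornerXsubC.
by rewrite mulrDr mulrCA IH; field.
Qed.

(** A nonempty sum of numbers with positive real part cannot vanish, so neither can the logarithmic
    derivative. *)
Lemma gauss_lucas s z : s != [::] ->
  (forall a, a \in s -> modulus a < modulus z) -> (poly_of_roots s)^`().[z] != 0.
Proof.
move=> s0 sz; suff : z * (poly_of_roots s)^`().[z] != 0.
  by rewrite mulf_eq0 negb_or => /andP[].
rewrite deriv_poly_of_roots// mulf_neq0 ?poly_of_roots_neq0//.
apply/eqP => /(congr1 (@complex.Re R)) /eqP; apply/negP; rewrite gt_eqF//=.
rewrite (raddf_sum (@complex.Re R : {additive R[i] -> R})) /=.
case: s s0 sz => [//|a s] _ sz; rewrite big_cons.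
rewrite ltr_pwDl ?Re_div_sub_gt0 ?sz ?mem_head//.
rewrite big_seq sumr_ge0// => b bs; rewrite ltW// Re_div_sub_gt0// sz//.
by rewrite inE bs orbT.
Qed.

End Derivative.

(** * The Mahler measure in terms of roots, reflection of roots, and reversal of polynomials *)

Section RootMeasure.
Context {R : realType}.
Implicit Types (z w u : R[i]) (s : seq R[i]) (p q : {poly R[i]}).

Definition root_seq p : seq R[i] := sval (closed_field_poly_normal p).

Lemma root_seqE p : p = lead_coef p *: poly_of_roots (root_seq p).
Proof. exact: svalP (closed_field_poly_normal p). Qed.

(** The quantity Ma of the overview; it is 0 for the zero polynomial. *)
Definition root_measure p : R :=
  modulus (lead_coef p) * \prod_(a <- root_seq p) Num.max 1 (modulus a).

Lemma lead_coef_poly_of_roots s : lead_coef (poly_of_roots s) = 1.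
Proof. exact/monicP/monic_prod_XsubC. Qed.

(** Any factorization computes the measure: by unique factorization, [s] is a permutation of the
    chosen root list. *)
Lemma root_measure_scale c s :
  root_measure (c *: poly_of_roots s) = modulus c * \prod_(a <- s) Num.max 1 (modulus a).
Proof.
have [->|c0] := eqVneq c 0; first by rewrite /root_measure scale0r lead_coef0 modulus0 !mul0r.
rewrite /root_measure lead_coefZ lead_coef_poly_of_roots mulr1; congr (_ * _).
apply: perm_big; apply: prod_XsubC_eq.
have := root_seqE (c *: poly_of_roots s).
rewrite lead_coefZ lead_coef_poly_of_roots mulr1.
by move/(scalerI c0)/esym.
Qed.

Lemma modulus_lead_coef_le p : modulus (lead_coef p) <= root_measure p.
Proof.
rewrite /root_measure ler_peMr ?modulus_ge0//.
elim/big_ind: _ => // [x y x1 y1|a _]; last by rewrite le_max lexx.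
by rewrite mulr_ege1.
Qed.

(** Up to sign, the constant term is the leading coefficient times the product of the roots. *)
Lemma modulus_coef0_le p : modulus p`_0 <= root_measure p.
Proof.
rewrite {1}[p]root_seqE coefZ modulusM /root_measure ler_wpM2l ?modulus_ge0//.
rewrite -horner_coef0 horner_poly_of_roots modulus_prod ler_prod// => a _.
by rewrite sub0r modulusN modulus_ge0 le_max lexx orbT.
Qed.

Lemma root_measure_mulX p : root_measure ('X * p) = root_measure p.
Proof.
rewrite [p]root_seqE -scalerAr -['X]subr0 -poly_of_roots_cons !root_measure_scale.
by rewrite big_cons modulus0 (max_idPl _) ?mul1r.
Qed.

Lemma root_measure_ge0 p : 0 <= root_measure p.
Proof. exact: le_trans (modulus_ge0 _) (modulus_lead_coef_le p). Qed.

(** Reflection in the unit circle of a root lying outside the closed disk. *)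
Definition inner_root a : R[i] := if modulus a <= 1 then a else (conjc a)^-1.

Lemma modulus_inner_root a : modulus (inner_root a) <= 1.
Proof.
rewrite /inner_root; case: ifPn => //; rewrite -ltNge => a1.
by rewrite modulusV modulusJ invf_le1 ?ltW// (lt_trans ltr01).
Qed.

(** For |a| > 1 the right side is |u conj(a) - 1|, and |u conj(a) - 1|^2 - |u - a|^2 = (|u|^2 -
    1)(|a|^2 - 1). *)
Lemma modulus_sub_inner_root a u : 1 < modulus u ->
  modulus (u - a) <= Num.max 1 (modulus a) * modulus (u - inner_root a).
Proof.
move=> u1; rewrite /inner_root; case: (leP (modulus a) 1) => [a1|a1]; first by rewrite mul1r.
have a0 : conjc a != 0 by rewrite -modulus_eq0 modulusJ gt_eqF// (lt_trans ltr01).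
rewrite -(modulusJ a) -modulusM mulrBr divff//.
rewrite -(ler_pXn2r (_ : 0 < 2)%N) ?nnegrE ?modulus_ge0// !sqr_modulus.
have : 0 <= (modulus u ^+ 2 - 1) * (modulus a ^+ 2 - 1).
  by rewrite mulr_ge0// subr_ge0 exprn_ege1// ltW.
rewrite !sqr_modulus {u1 a1 a0}; case: u => x y; case: a => c d /=.
by rewrite -subr_ge0; congr (0 <= _); ring.
Qed.

(* If the conclusion failed at z, then for w = p'(z)/q'(z), |w| > 1, the
   polynomial p - w q would have a critical point outside the closed disk which
   contains its roots. *)
Lemma modulus_deriv_le p q : (size p <= size q)%N ->
  modulus p`_(size q).-1 <= modulus (lead_coef q) ->
  (forall u, 1 < modulus u -> q.[u] != 0 /\ modulus p.[u] <= modulus q.[u]) ->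
  forall z, 1 < modulus z -> q^`().[z] != 0 -> modulus p^`().[z] <= modulus q^`().[z].
Proof.
move=> spq lpq pq z z1 q'z; rewrite leNgt; apply/negP => q'p'.
pose w := p^`().[z] / q^`().[z].
have w1 : 1 < modulus w by rewrite modulusM modulusV ltr_pdivlMr ?mul1r// modulus_gt0.
pose F := p - w *: q.
have q0 : q != 0 by apply: contraNneq q'z => ->; rewrite linear0 horner0.
have wl (x y : R[i]) : modulus x <= modulus y -> y != 0 -> x - w * y != 0.
  move=> xy y0; rewrite subr_eq0; apply: contraTneq xy => ->.
  by rewrite -ltNge modulusM ltr_pMl// modulus_gt0.
(* First use of [wl]: the top coefficients of [p] and [w *: q] do not cancel, so [F] is nonconstant
   and has roots to feed to Gauss-Lucas. The second use shows that none of them lies outside the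
   closed disk. *)
have Fq : F`_(size q).-1 != 0 by rewrite coefB coefZ wl// lead_coef_eq0.
have sq : (1 < size q)%N.
  rewrite ltnNge; apply: contraNN q'z => /size1_polyC ->.
  by rewrite derivC horner0.
have sF : (1 < size F)%N.
  rewrite (leq_trans sq)// -(prednK (ltnW sq)) ltnNge; apply: contraNN Fq => h.
  by rewrite nth_default.
have lF0 : lead_coef F != 0 by rewrite lead_coef_eq0 -size_poly_gt0 ltnW.
have : F^`().[z] == 0 by rewrite derivB derivZ hornerD hornerN hornerZ divfK// subrr.
rewrite (root_seqE F) derivZ hornerZ mulf_eq0 (negPf lF0) /=; apply/negP.
apply: gauss_lucas => [|a aF].
  by apply: contraTneq sF => r0; rewrite (root_seqE F) r0 /poly_of_roots big_nil size_scale// size_poly1.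
rewrite (le_lt_trans _ z1)// leNgt; apply/negP => /pq[qa pqa].
have /eqP : F.[a] != 0 by rewrite hornerD hornerN hornerZ wl.
apply; apply/eqP; rewrite (root_seqE F) hornerZ horner_poly_of_roots mulf_eq0 prodf_seq_eq0.
by apply/orP; right; apply/hasP; exists a; rewrite ?subrr /=.
Qed.

Lemma lead_coef_deriv p : lead_coef p^`() = lead_coef p *+ (size p).-1.
Proof.
have [p1|p1] := leqP (size p) 1.
  by rewrite (size1_polyC p1) derivC lead_coef0 size_polyC; case: eqP.
suff sp' : size p^`() = (size p).-1.
  by rewrite {1}/lead_coef sp' coef_deriv prednK// -subn1 subn_gt0.
apply/eqP; rewrite eqn_leq; apply/andP; split.
  by rewrite -ltnS (ltn_predK p1) lt_size_deriv// -size_poly_gt0 ltnW.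
rewrite -(@prednK (size p).-1) -?subn1 ?subn_gt0// !subn1 ltnNge; apply/negP => h.
have : p^`()`_(size p).-2 == 0 by rewrite nth_default.
rewrite coef_deriv prednK -?subn1 ?subn_gt0// subn1 -mulr_natr mulf_eq0.
by rewrite -/(lead_coef p) lead_coef_eq0 -size_poly_eq0 pnatr_eq0; case: (size p) p1 => [|[]].
Qed.

(** This is z^n p(1/z) for [p] of degree at most [n]; [n] is a parameter so that it can grow with
    each linear factor. *)
Definition rev_poly n p : {poly R[i]} := \poly_(i < n.+1) p`_(n - i).

Lemma coef_rev_poly n p i : (rev_poly n p)`_i = if (i <= n)%N then p`_(n - i) else 0.
Proof. by rewrite coef_poly ltnS. Qed.

(** Reversal is multiplicative, and X - a reverses to 1 - aX. The size bound kills the coefficient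
    of index [n.+1], which would otherwise survive in the constant term. *)
Lemma rev_poly_XsubC n a p : (size p <= n.+1)%N ->
  rev_poly n.+1 (('X - a%:P) * p) = (1 - a *: 'X) * rev_poly n p.
Proof.
move=> sp; apply/polyP => i; rewrite !mulrBl mul1r -scalerAl !(coefB, coefZ, coefCM, coefXM).
rewrite !coef_rev_poly coefB coefXM coefCM.
case: i => [|i] /=.
  by rewrite !subn0 /= [p`_n.+1]nth_default// !mulr0.
rewrite subSS ltnS; have [ni|ni|->] := ltngtP i n.
- by rewrite subn_eq0 leqNgt ni /= subnS.
- by rewrite mulr0 subr0.
- by rewrite subnn eqxx sub0r.
Qed.

Lemma rev_poly_of_roots s :
  rev_poly (size s) (poly_of_roots s) = \prod_(a <- s) (1 - a *: 'X).
Proof.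
elim: s => [|a s IH].
  rewrite /poly_of_roots !big_nil; apply/polyP => i.
  by rewrite coef_rev_poly !coef1; case: i.
by rewrite big_cons -IH -rev_poly_XsubC ?size_poly_of_roots// poly_of_roots_cons.
Qed.

(** The reversed polynomial has the inverse roots and leading coefficient p(0), and |a| max(1,
    1/|a|) = max(1, |a|) root by root. *)
Lemma root_measure_rev p : p`_0 != 0 -> root_measure (rev_poly (size p).-1 p) = root_measure p.
Proof.
move=> p0; set s := root_seq p; set c := lead_coef p.
have pE : p = c *: poly_of_roots s := root_seqE p.
have c0 : c != 0 by apply: contraNneq p0 => c0; rewrite pE c0 scale0r coef0.
have s0 : {in s, forall a, a != 0}.
  move=> a as_; apply: contraNneq p0 => a0; rewrite pE coefZ -horner_coef0.
  rewrite horner_poly_of_roots mulf_eq0 prodf_seq_eq0; apply/orP; right.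
  by apply/hasP; exists a; rewrite //= a0 subrr.
have -> : rev_poly (size p).-1 p =
    (c * \prod_(a <- s) - a) *: poly_of_roots [seq a^-1 | a <- s].
  have -> : (size p).-1 = size s by rewrite pE size_scale// size_poly_of_roots.
  rewrite /poly_of_roots big_map -scalerA -scaler_prod.
  have -> : \prod_(a <- s) (- a *: ('X - a^-1%:P)) = \prod_(a <- s) (1 - a *: 'X).
    apply: eq_big_seq => a /s0 a0.
    by rewrite scaleNr scalerBr -[a *: _^-1%:P]mul_polyC -polyCM divff// opprB.
  rewrite -rev_poly_of_roots; apply/polyP => i.
  by rewrite {1}pE coefZ !coef_rev_poly coefZ; case: ifP => //; rewrite mulr0.
rewrite root_measure_scale /root_measure modulusM -mulrA big_map modulus_prod -big_split /=.
congr (_ * _); apply: eq_big_seq => a /s0 a0.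
rewrite modulusN modulusV maxr_pMr ?modulus_ge0// mulr1 divff ?modulus_eq0//.
by rewrite maxC.
Qed.

End RootMeasure.

(** * Means of log|p| on circles and Jensen's formula *)

Section Circle.
Import numFieldNormedType.Exports.
Local Open Scope classical_set_scope.
Context {R : realType}.
Implicit Types (t r : R) (a z w : R[i]) (s : seq R[i]) (p : {poly R[i]}).
Local Notation mu := (@lebesgue_measure R).
Local Notation circ := (@unit_circle_point R).

Lemma modulus_circ t : modulus (circ t) = 1.
Proof.
by apply/eqP; rewrite -(pexpr_eq1 (n := 2))// ?modulus_ge0// sqr_modulus /= cos2Dsin2.
Qed.

Lemma circ_half t : circ (t + 2^-1) = - circ t.
Proof.
rewrite /unit_circle_point (_ : 2 * pi * (t + 2^-1) = 2 * pi * t + pi); last by field.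
by rewrite cosDpi sinDpi.
Qed.

Lemma circ_double t : circ (2 * t) = circ t ^+ 2.
Proof.
rewrite /unit_circle_point (_ : 2 * pi * (2 * t) = 2 * pi * t + 2 * pi * t); last by ring.
by rewrite cosD sinD expr2 /=; congr (_ +i* _)%C; ring.
Qed.

Lemma continuous_integrable (f : R -> R) (a b : R) : continuous f ->
  mu.-integrable `[a, b] (EFin \o f).
Proof.
move=> cf; apply: continuous_compact_integrable; first exact: segment_compact.
exact: continuous_subspaceT.
Qed.

Lemma Rintegral_affine (f : R -> R) (a b c d : R) : continuous f -> 0 < c -> a <= b ->
  \int[mu]_(x in `[c * a + d, c * b + d]) f x = c * \int[mu]_(x in `[a, b]) f (c * x + d).
Proof.
move=> cf c0 ab; pose F x : R := c * x + d.
have dF x : is_derive x (1 : R) F c.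
  by rewrite /F; apply: is_derive_eq; rewrite addr0 /GRing.scale /= mulr1.
have F' : F^`() = cst c by apply/funext => x; rewrite derive1E derive_val.
have cF : continuous F by move=> x; apply/differentiable_continuous/derivable1_diffP.
have cfF : continuous (fun x => f (c * x + d)).
  by move=> x; apply: (@continuous_comp _ _ _ F f); [exact: cF|exact: cf].
rewrite -RintegralZl//; last exact: continuous_integrable.
rewrite /Rintegral (@integration_by_substitution_increasing _ F f a b)//.
- by congr fine; apply: eq_integral => x _; rewrite /= F' /F mulrC.
- by move=> x y _ _ xy; rewrite /F ltrD2r ltr_pM2l.
- by rewrite F' => x _; exact: cvg_cst.
- by rewrite F'; exact: is_cvg_cst.
- by rewrite F'; exact: is_cvg_cst.
- split => [x _| |]; first by [].
  + exact/cvg_at_right_filter/cF.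
  + exact/cvg_at_left_filter/cF.
- exact: continuous_subspaceT.
Qed.

(** Substituting 2t turns the integral of [g] into twice an integral over [0, 1/2], where the two
    summands of [fg] cover the two halves of [0, 1]. *)
Lemma Rintegral_double (f g : R -> R) : continuous f -> continuous g ->
  (forall t, f t + f (t + 2^-1) = g (2 * t)) ->
  \int[mu]_(t in `[0, 1]) g t = 2 * \int[mu]_(t in `[0, 1]) f t.
Proof.
move=> cf cg fg.
have cf2 : continuous (fun t => f (t + 2^-1)).
  move=> x; apply: (@continuous_comp _ _ _ (fun t => t + 2^-1) f); last exact: cf.
  by apply: cvgD; [exact: cvg_id|exact: cvg_cst].
have -> : \int[mu]_(t in `[0, 1]) g t = 2 * \int[mu]_(t in `[0, 2^-1]) g (2 * t).
  have := @Rintegral_affine g 0 2^-1 2 0 cg.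
  rewrite mulr0 !addr0 mulfV// => ->//.
  by congr (_ * _); apply: eq_Rintegral => t _; rewrite addr0.
congr (_ * _).
under eq_Rintegral do rewrite -fg.
rewrite RintegralD//; [|exact: continuous_integrable..].
have -> : \int[mu]_(t in `[0, 2^-1]) f (t + 2^-1) = \int[mu]_(t in `[2^-1, 1]) f t.
  have := @Rintegral_affine f 0 2^-1 1 2^-1 cf.
  rewrite mulr0 add0r !mul1r (_ : 2^-1 + 2^-1 = 1 :> R); last by field.
  by move=> ->//; apply: eq_Rintegral => t _; rewrite mul1r.
(* Subtracting the first half leaves the half-open interval ]1/2, 1]; adding its endpoint does not
   change the integral. *)
rewrite -[RHS](subrK (\int[mu]_(t in `[0, 2^-1]) f t)) Rintegral_itvB//.
- rewrite addrC Rintegral_itv_obnd_cbnd//.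
  apply: (integrableS _ _ _ (continuous_integrable f 2^-1 1 cf)) => //.
  by apply: subset_itvr; rewrite bnd_simp.
- exact: continuous_integrable.
- by rewrite bnd_simp invr_ge0.
- by rewrite bnd_simp invf_le1// ler1n.
Qed.

Lemma cvg_modulus (T : Type) (F : set_system T) (FF : Filter F) (f g : T -> R) (x y : R) :
  f @ F --> x -> g @ F --> y -> modulus (f t +i* g t)%C @[t --> F] --> modulus (x +i* y)%C.
Proof.
move=> fx gy; rewrite modulusE; under eq_fun do rewrite modulusE.
apply: continuous_cvg; first exact: sqrt_continuous.
by apply: cvgD; rewrite expr2; (under eq_fun do rewrite expr2); apply: cvgM.
Qed.

(** By factorization, the modulus is a product of distances to the roots. The filter is arbitrary
    because the lemma serves both continuity in the angle and convergence along a sequence of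
    radii. *)
Lemma cvg_modulus_horner (T : Type) (F : set_system T) (FF : Filter F) (f g : T -> R)
    (x y : R) p :
  f @ F --> x -> g @ F --> y ->
  modulus p.[(f t +i* g t)%C] @[t --> F] --> modulus p.[(x +i* y)%C].
Proof.
move=> fx gy; rewrite (root_seqE p); set c := lead_coef p; set s := root_seq p.
have hE z : modulus (c *: poly_of_roots s).[z] = modulus c * \prod_(a <- s) modulus (z - a).
  by rewrite hornerZ modulusM horner_poly_of_roots modulus_prod.
rewrite hE; under eq_fun do rewrite hE.
apply: cvgMr; elim: s {hE} => [|[u v] s IH].
  by rewrite big_nil; under eq_fun do rewrite big_nil; exact: cvg_cst.
rewrite big_cons; under eq_fun do rewrite big_cons.
apply: cvgM IH; apply: cvg_modulus; apply: cvgB => //; exact: cvg_cst.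
Qed.

Lemma scale_circ r t :
  (r%:C%C * circ t) = (r * cos (2 * pi * t) +i* (r * sin (2 * pi * t)))%C.
Proof. by rewrite /unit_circle_point /real_complex_def; congr (_ +i* _)%C; rewrite ?mul0r ?subr0 ?addr0. Qed.

Lemma continuous_modulus_circ r p : continuous (fun t => modulus p.[r%:C%C * circ t]).
Proof.
move=> t; rewrite /continuous_at scale_circ; under eq_fun do rewrite scale_circ.
have ct : 2 * pi * x @[x --> t] --> 2 * pi * t by apply: cvgMr; exact: cvg_id.
have cc : cos (2 * pi * x) @[x --> t] --> cos (2 * pi * t).
  by apply: continuous_cvg ct; exact: continuous_cos.
have cs : sin (2 * pi * x) @[x --> t] --> sin (2 * pi * t).
  by apply: continuous_cvg ct; exact: continuous_sin.
by apply: cvg_modulus_horner; apply: cvgMr.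
Qed.

Lemma continuous_ln_circ r p : (forall t, p.[r%:C%C * circ t] != 0) ->
  continuous (fun t => ln (modulus p.[r%:C%C * circ t])).
Proof.
move=> p0 t; apply: continuous_comp; first exact: continuous_modulus_circ.
by apply: continuous_ln; rewrite modulus_gt0.
Qed.

Definition circle_mean r p : R := \int[mu]_(t in `[0, 1]) ln (modulus p.[r%:C%C * circ t]).

Lemma circle_mean_const r c : circle_mean r c%:P = ln (modulus c).
Proof.
rewrite /circle_mean; under eq_Rintegral do rewrite hornerC.
by rewrite Rintegral_cst//= lebesgue_measure_itv /= lte_fin ltr01 sube0 mulr1.
Qed.

Lemma circle_mean_mul r p q : (forall t, p.[r%:C%C * circ t] != 0) ->
  (forall t, q.[r%:C%C * circ t] != 0) ->
  circle_mean r (p * q) = circle_mean r p + circle_mean r q.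
Proof.
move=> p0 q0; rewrite /circle_mean -RintegralD//; last 2 first.
- exact/continuous_integrable/continuous_ln_circ.
- exact/continuous_integrable/continuous_ln_circ.
by apply: eq_Rintegral => t _; rewrite hornerM modulusM lnM ?posrE ?modulus_gt0.
Qed.

Lemma le_circle_mean r p q : (forall t, p.[r%:C%C * circ t] != 0) ->
  (forall t, modulus p.[r%:C%C * circ t] <= modulus q.[r%:C%C * circ t]) ->
  circle_mean r p <= circle_mean r q.
Proof.
move=> p0 pq.
have q0 t : q.[r%:C%C * circ t] != 0.
  by rewrite -modulus_gt0 (lt_le_trans _ (pq t))// modulus_gt0.
apply: le_Rintegral => // [||t _].
- exact/continuous_integrable/continuous_ln_circ.
- exact/continuous_integrable/continuous_ln_circ.
- by rewrite ler_ln ?posrE ?modulus_gt0.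
Qed.

Lemma sub_circ_neq0 r t a : 0 < r -> modulus a != r -> r%:C%C * circ t - a != 0.
Proof.
move=> r0; apply: contraNneq => /subr0_eq <-.
by rewrite modulusM modulus_circ mulr1 modulus_real ?ltW.
Qed.

(* (e(t) - a) (e(t + 1/2) - a) = - (e(2t) - a^2) *)
Lemma circle_mean_double a : modulus a != 1 ->
  circle_mean 1 ('X - (a ^+ 2)%:P) = 2 * circle_mean 1 ('X - a%:P).
Proof.
move=> a1.
have a21 : modulus (a ^+ 2) != 1 by rewrite modulusX pexpr_eq1 ?modulus_ge0.
apply: Rintegral_double => [||t].
- by apply: continuous_ln_circ => t; rewrite hornerXsubC sub_circ_neq0.
- by apply: continuous_ln_circ => t; rewrite hornerXsubC sub_circ_neq0.
rewrite circ_half circ_double !hornerXsubC !mul1r.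
have ta : circ t - a != 0 by rewrite -[circ t]mul1r (sub_circ_neq0 1).
have ta' : - circ t - a != 0 by rewrite -circ_half -[circ _]mul1r (sub_circ_neq0 1).
rewrite -lnM ?posrE ?modulus_gt0// -modulusM -modulusN; congr (ln (modulus _)).
by ring.
Qed.

(* Iterating circle_mean_double multiplies the mean by 2^m, but the means at the
   points a^(2^m) are bounded. *)
Lemma circle_mean_lt1 a : modulus a < 1 -> circle_mean 1 ('X - a%:P) = 0.
Proof.
(* If |b| <= rho then 1 - rho <= |e(t) - b| <= 2, so the logarithm lies between ln(1 - rho) <= 0 and
   ln 2 >= 0. *)
move=> a1; set rho := modulus a in a1; pose C := ln 2 - ln (1 - rho).
have rho1 : 0 < 1 - rho by rewrite subr_gt0.
have bound b : modulus b <= rho -> `|circle_mean 1 ('X - b%:P)| <= C.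
  move=> ba.
  have b1 : modulus b != 1 by rewrite lt_eqF// (le_lt_trans ba).
  have cb : continuous (fun t => ln (modulus ('X - b%:P).[1%:C%C * circ t])).
    by apply: continuous_ln_circ => t; rewrite hornerXsubC sub_circ_neq0.
  apply: le_trans (le_normr_Rintegral _ (continuous_integrable _ 0 1 cb)) _ => //.
  have -> : C = \int[mu]_(t in `[0, 1]) C.
    by rewrite Rintegral_cst//= lebesgue_measure_itv /= lte_fin ltr01 sube0 mulr1.
  apply: le_Rintegral => // [||t _].
  - apply: (continuous_integrable (fun t => `|ln (modulus ('X - b%:P).[1%:C%C * circ t])|)).
    by move=> t; apply: cvg_norm; exact: cb.
  - by apply: (continuous_integrable (fun=> C)) => t; exact: cvg_cst.
  rewrite hornerXsubC mul1r.
  have tb : 0 < modulus (circ t - b) by rewrite modulus_gt0 -[circ t]mul1r (sub_circ_neq0 1).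
  have ub : ln (modulus (circ t - b)) <= ln 2.
    rewrite ler_ln ?posrE// (le_trans (modulusD _ _))// modulusN modulus_circ.
    by rewrite (_ : 2 = 1 + 1)// lerD2l (le_trans ba)// ltW.
  have lb : ln (1 - rho) <= ln (modulus (circ t - b)).
    rewrite ler_ln ?posrE// lerBlDr -(modulus_circ t).
    rewrite -[circ t in leLHS](subrK b) (le_trans (modulusD _ _))// lerD2l//.
  have ln2 : 0 <= ln 2 :> R by rewrite ln_ge0// ler1n.
  have ln1 : ln (1 - rho) <= 0 by rewrite ln_le0// lerBlDr lerDl modulus_ge0.
  by rewrite /C ler_norml; apply/andP; split; lra.
have iter m b : modulus b <= rho -> 2 ^+ m * `|circle_mean 1 ('X - b%:P)| <= C.
  elim: m b => [|m IH] b ba; first by rewrite mul1r bound.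
  rewrite exprSr -mulrA -[X in X * `|_|]ger0_norm// -normrM -circle_mean_double.
    by rewrite IH// modulusX (le_trans _ ba)// expr2 ler_piMr ?modulus_ge0// (le_trans ba)// ltW.
  by rewrite lt_eqF// (le_lt_trans ba).
apply/eqP; rewrite -normr_le0 leNgt; apply/negP => K0.
(* An exponent m above C / |mean| suffices, since 2^m > m. *)
have := iter (Num.truncn (C / `|circle_mean 1 ('X - a%:P)|)).+1 a (lexx _).
apply/negP; rewrite -ltNge -ltr_pdivrMr//.
apply: (lt_le_trans (truncnS_gt _)); rewrite -natrX ler_nat.
exact/ltnW/ltn_expl.
Qed.

(** Both cases reduce to [circle_mean_lt1]: |r e(t) - a| equals r |e(t) - a/r|, and also |a| |e(t) -
    r/conj(a)|; the first serves for |a| < r, the second for |a| > r. *)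
Lemma circle_mean_XsubC r a : 0 < r -> modulus a != r ->
  circle_mean r ('X - a%:P) = ln (Num.max r (modulus a)).
Proof.
move=> r0 ar; have rC0 : r%:C%C != 0 by rewrite -modulus_gt0 modulus_real ?ltW.
have [ar'|ar'] : modulus a < r \/ r < modulus a by move: ar; case: ltgtP; [left|right|].
- have b1 : modulus (a / r%:C%C) < 1.
    by rewrite modulusM modulusV modulus_real ?ltW// ltr_pdivrMr ?mul1r.
  rewrite (max_idPl _) ?ltW//.
  have -> : ln r = circle_mean 1 (r%:C%C)%:P by rewrite circle_mean_const modulus_real ?ltW.
  rewrite -[RHS]addr0 -(circle_mean_lt1 _ b1) -circle_mean_mul.
  + apply: eq_Rintegral => t _; rewrite hornerM hornerC !hornerXsubC mul1r mulrBr.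
    by rewrite mulrCA divff// mulr1.
  + by move=> t; rewrite hornerC.
  + by move=> t; rewrite hornerXsubC sub_circ_neq0// lt_eqF.
- have a0 : 0 < modulus a by rewrite (lt_trans r0).
  have aN0 : conjc a != 0 by rewrite -modulus_gt0 modulusJ.
  have b1 : modulus (r%:C%C / conjc a) < 1.
    by rewrite modulusM modulusV modulusJ modulus_real ?ltW// ltr_pdivrMr ?mul1r.
  rewrite (max_idPr _) ?ltW//.
  rewrite -[RHS]addr0 -(circle_mean_lt1 _ b1) -(modulusJ a).
  rewrite -(circle_mean_const 1) -circle_mean_mul.
  + apply: eq_Rintegral => t _; congr ln.
    rewrite hornerM hornerC !hornerXsubC mul1r mulrBr mulrCA divff// mulr1.
    have /(congr1 (fun x => x ^+ 2)) := modulus_circ t.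
    rewrite sqr_modulus expr1n; case: (circ t) => x y /= xy.
    have {}xy : y ^+ 2 = 1 - x ^+ 2 by rewrite -xy addrC addKr.
    apply/eqP; rewrite -(eqrXn2 (_ : 0 < 2)%N) ?modulus_ge0//; apply/eqP.
    by case: (a) => c d; rewrite !sqr_modulus /=; ring: xy.
  + by move=> t; rewrite hornerC.
  + by move=> t; rewrite hornerXsubC sub_circ_neq0// lt_eqF.
Qed.

Lemma jensen r c s : 0 < r -> c != 0 -> (forall a, a \in s -> modulus a != r) ->
  circle_mean r (c *: poly_of_roots s) =
  ln (modulus c * \prod_(a <- s) Num.max r (modulus a)).
Proof.
move=> r0 c0; rewrite -mul_polyC; elim: s => [|a s IH] sr.
  by rewrite /poly_of_roots !big_nil !mulr1 circle_mean_const.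
have sr' b : b \in s -> modulus b != r by move=> bs; apply: sr; rewrite inE bs orbT.
have max0 b : 0 < Num.max r (modulus b) by rewrite lt_max r0.
rewrite poly_of_roots_cons mulrCA circle_mean_mul.
- rewrite IH// circle_mean_XsubC ?sr ?mem_head// -lnM ?posrE//.
    by rewrite big_cons mulrCA.
  by rewrite mulr_gt0 ?modulus_gt0// prodr_gt0.
- by move=> t; rewrite hornerXsubC sub_circ_neq0// sr ?mem_head.
- move=> t; rewrite hornerM hornerC mulf_neq0// horner_poly_of_roots.
  by rewrite prodf_seq_neq0; apply/allP => b /sr' br; rewrite sub_circ_neq0.
Qed.

End Circle.

(** * Approaching the unit circle from outside: Mahler's derivative inequality and the bound by the
    Mahler measure *)

Section MahlerMeasure.
Import numFieldNormedType.Exports.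
Local Open Scope classical_set_scope.
Context {R : realType}.
Implicit Types (t r : R) (a z u : R[i]) (s : seq R[i]) (p q : {poly R[i]}).
Local Notation mu := (@lebesgue_measure R).
Local Notation I01 := (`[0%R, 1%R]%classic : set R).
Local Notation circ := (@unit_circle_point R).

(** A finite list has finitely many moduli, so Jensen's formula applies on all circles of radius
    slightly above [b]. *)
Lemma near_modulus_neq s (b : R) :
  \forall r \near b^'+, forall a, a \in s -> modulus a != r.
Proof.
elim: s => [|a s IH]; first by near=> r.
have ar : \forall r \near b^'+, modulus a != r.
  have [ab|ba] := leP (modulus a) b.
    by near=> r; rewrite lt_eqF// (le_lt_trans ab).
  by near=> r; rewrite gt_eqF//; near: r; exact: nbhs_right_lt.
near=> r => c; rewrite inE => /predU1P[{c}->|cs]; first by near: r.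
by move: c cs; near: r; exact: IH.
Unshelve. all: by end_near. Qed.

Lemma root_seq_neq0 p z : p.[z] != 0 -> z \notin root_seq p.
Proof.
apply: contraNN => zp; rewrite (root_seqE p) hornerZ horner_poly_of_roots mulf_eq0.
by rewrite prodf_seq_eq0; apply/orP; right; apply/hasP; exists z; rewrite //= subrr.
Qed.

Lemma circle_mean_root_seq r p : 0 < r -> p != 0 ->
  (forall a, a \in root_seq p -> modulus a != r) ->
  circle_mean r p = ln (modulus (lead_coef p) * \prod_(a <- root_seq p) Num.max r (modulus a)).
Proof. by move=> r0 p0 pr; rewrite {1}(root_seqE p) jensen// lead_coef_eq0. Qed.

Lemma horner_circ_neq0 r p : 0 < r -> p != 0 ->
  (forall a, a \in root_seq p -> modulus a != r) ->
  forall t, p.[r%:C%C * circ t] != 0.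
Proof.
move=> r0 p0 pr t; rewrite (root_seqE p) hornerZ mulf_neq0 ?lead_coef_eq0//.
rewrite horner_poly_of_roots prodf_seq_neq0; apply/allP => b /pr br /=.
by rewrite sub_circ_neq0.
Qed.

Lemma root_measure_le r p : 1 <= r ->
  root_measure p <= modulus (lead_coef p) * \prod_(a <- root_seq p) Num.max r (modulus a).
Proof.
move=> r1; rewrite /root_measure ler_wpM2l ?modulus_ge0// ler_prod// => a _.
rewrite le_max ler01 /= ge_max !le_max r1 lexx orbT//.
Qed.

Lemma root_measure_gt0 p : p != 0 -> 0 < root_measure p.
Proof.
move=> p0; rewrite (lt_le_trans _ (modulus_lead_coef_le p))//.
by rewrite modulus_gt0 lead_coef_eq0.
Qed.

(** All roots of [q] lie in the closed unit disk, so Jensen on |z| = r > 1 bounds the measure of [p]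
    by |lead(q)| r^deg(q); then r tends to 1. *)
Lemma root_measure_le_lead_coef p q :
  (forall u, 1 < modulus u -> q.[u] != 0 /\ modulus p.[u] <= modulus q.[u]) ->
  root_measure p <= modulus (lead_coef q).
Proof.
move=> pq; have [->|p0] := eqVneq p 0.
  by rewrite /root_measure lead_coef0 modulus0 mul0r modulus_ge0.
have q0 : q != 0.
  have /pq[+ _] : 1 < modulus (2%:R : R[i]) by rewrite modulus_nat ltr1n.
  by apply: contraNneq => ->; rewrite horner0.
have roots_q a : a \in root_seq q -> modulus a <= 1.
  by move=> aq; rewrite leNgt; apply/negP => /pq[/root_seq_neq0]; rewrite aq.
have lim : modulus (lead_coef q) * r ^+ size (root_seq q) @[r --> 1^'+] --> modulus (lead_coef q).
  rewrite -[X in _ --> X]mulr1 -[X in _ * X](expr1n _ (size (root_seq q))).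
  apply: cvgMr; apply: cvg_at_right_filter; exact: exprn_continuous.
apply: (cvgr_to_ge lim); near=> r.
have r1 : 1 < r by near: r; exact: nbhs_right_gt.
have r0 : 0 < r by rewrite (lt_trans ltr01).
have pr a : a \in root_seq p -> modulus a != r.
  by move: a; near: r; exact: near_modulus_neq.
have qr a : a \in root_seq q -> modulus a != r.
  by move/roots_q => a1; rewrite lt_eqF// (le_lt_trans a1).
have max0 a : 0 < Num.max r (modulus a) by rewrite lt_max r0.
have pqr : circle_mean r p <= circle_mean r q.
  apply: le_circle_mean => [|t]; first exact: horner_circ_neq0.
  by apply: (pq _ _).2; rewrite modulusM modulus_circ mulr1 modulus_real// ltW.
rewrite (le_trans (root_measure_le _ _ (ltW r1)))//.
move: pqr; rewrite !circle_mean_root_seq// ler_ln ?posrE//; first last.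
- by rewrite mulr_gt0 ?modulus_gt0 ?lead_coef_eq0// prodr_gt0.
- by rewrite mulr_gt0 ?modulus_gt0 ?lead_coef_eq0// prodr_gt0.
move=> /le_trans; apply; rewrite ler_wpM2l ?modulus_ge0//.
rewrite (eq_big_seq (fun=> r)) => [|a /roots_q a1]; last by rewrite (max_idPl _)// (le_trans a1)// ltW.
by rewrite big_const_seq count_predT iter_mulr_1.
Unshelve. all: by end_near. Qed.
Lemma root_measure_deriv p : root_measure p^`() <= (size p).-1%:R * root_measure p.
Proof.
have [p1|p1] := leqP (size p) 1.
  rewrite (size1_polyC p1) derivC /root_measure lead_coef0 modulus0 mul0r.
  by rewrite mulr_ge0// root_measure_ge0.
have p0 : p != 0 by rewrite -size_poly_gt0 ltnW.
set s := root_seq p; set c := lead_coef p.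
have c0 : c != 0 by rewrite lead_coef_eq0.
have sp : size p = (size s).+1 by rewrite (root_seqE p) size_scale// size_poly_of_roots.
pose d : R[i] := (root_measure p)%:C%C.
have d0 : d != 0 by rewrite -modulus_eq0 modulus_real ?root_measure_ge0// gt_eqF// root_measure_gt0.
(* The leading coefficient [d] absorbs the factors max(1, |a|) lost in [modulus_sub_inner_root], so
   [q] dominates [p] outside the disk. *)
pose q := d *: poly_of_roots [seq inner_root a | a <- s].
have sq : size q = size p by rewrite size_scale// size_poly_of_roots size_map sp.
have lq : lead_coef q = d by rewrite lead_coefZ lead_coef_poly_of_roots mulr1.
have in1 a u : 1 < modulus u -> a \in [seq inner_root a | a <- s] -> modulus a < modulus u.
  by move=> u1 /mapP[b _ ->]; rewrite (le_lt_trans (modulus_inner_root b)).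
have q'0 u : 1 < modulus u -> q^`().[u] != 0.
  move=> u1; rewrite derivZ hornerZ mulf_neq0// gauss_lucas//.
    by rewrite -size_eq0 size_map -lt0n -ltnS -sp.
  by move=> a; exact: in1.
rewrite (le_trans (root_measure_le_lead_coef _ q^`() _))//; last first.
  by rewrite lead_coef_deriv sq lq -[d *+ _]mulr_natl modulusM modulus_nat modulus_real// root_measure_ge0.
move=> u u1; split; first exact: q'0.
apply: modulus_deriv_le => //; last exact: q'0.
- by rewrite sq.
- by rewrite sq lq modulus_real ?root_measure_ge0// modulus_lead_coef_le.
move=> v v1; split.
  by rewrite hornerZ mulf_neq0// poly_of_roots_neq0// => a; exact: in1.
rewrite {1}(root_seqE p) !hornerZ !horner_poly_of_roots !modulusM modulus_real ?root_measure_ge0//.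
rewrite /root_measure -mulrA ler_wpM2l ?modulus_ge0// big_map !modulus_prod -big_split /=.
by rewrite ler_prod// => a _; rewrite modulus_ge0 modulus_sub_inner_root.
Qed.

Lemma le_limn_einf (u : (\bar R)^nat) (x : \bar R) :
  (\forall n \near \oo, x <= u n)%E -> (x <= limn_einf u)%E.
Proof.
move=> [N _ xu]; rewrite limn_einf_lim; apply: lime_ge; first exact: is_cvg_einfs.
exists N => // n /= Nn; apply: le_ereal_inf_tmp => _ [m /= nm <-].
exact/xu/(leq_trans Nn).
Qed.

Lemma limn_einf_le (u : (\bar R)^nat) (x : \bar R) :
  (forall n, u n <= x)%E -> (limn_einf u <= x)%E.
Proof.
move=> ux; rewrite limn_einf_lim; apply: lime_le; first exact: is_cvg_einfs.
by apply: nearW => n; rewrite (le_trans _ (ux n))//; apply: ereal_inf_lbound; exists n => /=.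
Qed.

Lemma modulus_horner_bound p r z : modulus z <= r ->
  modulus p.[z] <= \sum_(i < size p) modulus p`_i * r ^+ i.
Proof.
move=> zr; rewrite horner_coef (le_trans (modulus_sum _ _ _))// ler_sum// => i _.
by rewrite modulusM modulusX ler_wpM2l ?modulus_ge0// lerXn2r ?nnegrE ?modulus_ge0// (le_trans _ zr)// modulus_ge0.
Qed.

(* The circle |z| = 1 may carry zeros, so it is approached from outside; Fatou's
   lemma then gives both integrability and the inequality. At the zeros, where
   [ln 0 = 0], the integrand stays below the lower limit. *)
Lemma root_measure_le_mahler p : p != 0 -> root_measure p <= mahler p.
Proof.
move=> p0.
(* A bound for |p| on |z| <= 2; the summand 1 makes ln B nonnegative, so that [lnC] also holds at
   zeros of [p]. *)
pose B := 1 + \sum_(i < size p) modulus p`_i * 2 ^+ i.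
have B1 : 1 <= B.
  by rewrite lerDl sumr_ge0// => i _; rewrite mulr_ge0// modulus_ge0.
pose C := ln B.
have C0 : 0 <= C by rewrite ln_ge0.
have lnC z : modulus z <= 2 -> ln (modulus p.[z]) <= C.
  move=> z2; have [->|pz] := eqVneq p.[z] 0; first by rewrite modulus0 ln0.
  rewrite ler_ln ?posrE ?modulus_gt0// ?(lt_le_trans ltr01)//.
  by rewrite (le_trans (modulus_horner_bound _ _ _ z2))// lerDr.
have [e /= e0 he] := near_modulus_neq (root_seq p) 1.
have [N /= Ne] : exists N, forall n, (N <= n)%N -> @harmonic R n < e.
  have := @cvg_harmonic R => /cvgrPdist_lt/(_ _ e0)[N _ hN].
  by exists N => n /hN /=; rewrite sub0r normrN ger0_norm// invr_ge0.
(* Radii in ]1, 2] tending to 1; the shift by [N] keeps them where no root has that modulus. *)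
pose r (n : nat) : R := 1 + harmonic (n + N).
have r_gt1 n : 1 < r n by rewrite ltrDl /= invr_gt0.
have r0 n : 0 < r n by rewrite (lt_trans ltr01).
have r2 n : r n <= 2 by rewrite /r (_ : 2 = 1 + 1)// lerD2l /= invf_le1// ler1n.
have rp n a : a \in root_seq p -> modulus a != r n.
  apply: he; last exact: r_gt1.
  by rewrite /= /r opprD addrA subrr sub0r normrN ger0_norm ?invr_ge0// Ne// leq_addl.
have r_cvg : r @ \oo --> (1 : R).
  rewrite -[X in _ --> X]addr0; apply: cvgD; first exact: cvg_cst.
  by rewrite (cvg_shiftn N); exact: cvg_harmonic.
have cr n t : modulus ((r n)%:C%C * circ t) <= 2.
  by rewrite modulusM modulus_circ mulr1 modulus_real// ltW.
have rN0 n t : p.[(r n)%:C%C * circ t] != 0 by exact: (horner_circ_neq0 _ _ (r0 n) p0 (rp n) t).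
(* Subtracting from [C] gives the nonnegative functions that Fatou's lemma requires. *)
pose psi t := C - ln (modulus p.[circ t]).
pose psin (n : nat) t := C - ln (modulus p.[(r n)%:C%C * circ t]).
have psi0 t : 0 <= psi t by rewrite subr_ge0 lnC// modulus_circ ler1n.
have psin0 n t : 0 <= psin n t by rewrite subr_ge0 lnC.
have cpsin n : continuous (psin n).
  move=> t; apply: cvgB; first exact: cvg_cst.
  exact: (continuous_ln_circ (r n) p (rN0 n)).
have mcirc : measurable_fun setT (fun t => ln (modulus p.[circ t])).
  apply: (measurableT_comp (@measurable_ln R)); apply: continuous_measurable_fun.
  by have := continuous_modulus_circ 1 p; under eq_fun do rewrite mul1r.
have mpsi : measurable_fun I01 psi.
  apply: measurable_funTS; exact: (measurable_funB (measurable_cst C) mcirc).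
have mpsin n : measurable_fun I01 (psin n).
  by apply: measurable_funTS; exact: continuous_measurable_fun (cpsin n).
have cvg_p t : modulus p.[(r n)%:C%C * circ t] @[n --> \oo] --> modulus p.[circ t].
  rewrite -[circ t in X in _ --> X]mul1r scale_circ; under eq_fun do rewrite scale_circ.
  by apply: cvg_modulus_horner; apply: cvgMl.
have int_psin n : \int[mu]_(t in I01) psin n t = C - circle_mean (r n) p.
  rewrite RintegralB//; last 2 first.
  - by apply: (continuous_integrable (fun=> C)) => t; exact: cvg_cst.
  - exact/continuous_integrable/continuous_ln_circ.
  by rewrite Rintegral_cst//= lebesgue_measure_itv /= lte_fin ltr01 sube0 mulr1.
have int_psin_le n : (\int[mu]_(t in I01) (psin n t)%:E <= (C - ln (root_measure p))%R%:E)%E.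
  rewrite -[leLHS]fineK; last first.
    by apply: integrable_fin_num => //; exact: (continuous_integrable _ 0 1 (cpsin n)).
  rewrite lee_fin -/(Rintegral mu I01 (psin n)) int_psin lerB//.
  (* Jensen at radius [r n] > 1 gives at least the logarithm of the root measure. *)
  rewrite circle_mean_root_seq//; last exact: rp.
  rewrite ler_ln ?posrE ?root_measure_gt0//; first exact/root_measure_le/ltW.
  rewrite mulr_gt0 ?modulus_gt0 ?lead_coef_eq0// prodr_gt0// => a _.
  by rewrite lt_max r0.
have int_psi : (\int[mu]_(t in I01) (psi t)%:E <= (C - ln (root_measure p))%R%:E)%E.
  apply: (@le_trans _ _ (\int[mu]_(t in I01) limn_einf (fun n => (psin n t)%:E))%E).
    apply: ge0_le_integral => //.
    - by move=> t _; rewrite lee_fin.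
    - exact/measurable_EFinP.
    - rewrite [X in measurable_fun _ X](_ : _ =
        (fun t => - limn_esup (fun n => - (psin n t)%:E))%E); last by [].
      apply: measurableT_comp => //; apply: measurable_fun_limn_esup => n.
      apply: measurableT_comp => //; apply/measurable_EFinP.
      exact: mpsin.
    move=> t _; have [pt|pt] := eqVneq p.[circ t] 0.
      (* At a zero [psi t] is [C], and [psin n t] is at least [C] once |p| < 1 at the nearby
         point. *)
      have := cvg_p t; rewrite pt modulus0 => /cvgrPdist_lt/(_ _ ltr01) near1.
      apply: le_limn_einf; apply: filterS near1 => n.
      rewrite sub0r normrN ger0_norm ?modulus_ge0// => p1.
      by rewrite lee_fin /psi /psin pt modulus0 ln0// lerB// ln_le0// ltW.
    have psi_cvg : (psin n t)%:E @[n --> \oo] --> (psi t)%:E.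
      apply: cvg_EFin; first exact: nearW.
      apply: cvgB; first exact: cvg_cst.
      by apply: continuous_cvg (cvg_p t); apply: continuous_ln; rewrite modulus_gt0.
    rewrite is_cvg_limn_einfE; last by apply/cvg_ex; exists (psi t)%:E.
    by rewrite (cvg_lim _ psi_cvg).
  apply: le_trans (fatou _ _ _ _) _ => //.
  - move=> n; apply/measurable_EFinP.
    exact: mpsin.
  - by move=> n t _; rewrite lee_fin.
  exact: limn_einf_le.
(* A nonnegative function with finite integral is integrable, which allows writing [log_mahler p] as
   [C] minus the integral of [psi]. *)
have psi_int : mu.-integrable I01 (EFin \o psi).
  apply/integrableP; split; first exact/measurable_EFinP.
  under eq_integral do rewrite /= ger0_norm//.
  by rewrite (le_lt_trans int_psi) ?ltry.
have int_psiR : \int[mu]_(t in I01) psi t <= C - ln (root_measure p).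
  rewrite -lee_fin /Rintegral fineK//; exact: integrable_fin_num.
rewrite /mahler -[leLHS]lnK ?posrE ?root_measure_gt0// ler_expR.
have -> : log_mahler p = C - \int[mu]_(t in I01) psi t.
  rewrite -[X in X - _](_ : \int[mu]_(t in I01) C = C); last first.
    by rewrite Rintegral_cst//= lebesgue_measure_itv /= lte_fin ltr01 sube0 mulr1.
  rewrite -RintegralB//; last first.
    by apply: (continuous_integrable (fun=> C)) => t; exact: cvg_cst.
  by apply: eq_Rintegral => t _; rewrite /psi opprB addrCA subrr addr0.
by rewrite lerBrDl -lerBrDr.
Qed.

End MahlerMeasure.

(** * Coefficient bounds by induction on the number of monomials *)

Section SparseCoefficients.
Context {R : realType}.
Implicit Types (p q : {poly R[i]}) (s : seq nat).

(** The list [s] only has to contain the exponents that occur, so zero coefficients are harmless.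
    Counting from two monomials makes the base constant 1. *)
Definition coef_bound k := forall s p, (size s <= k.+2)%N ->
  (forall i, p`_i != 0 -> i \in s) ->
  forall j, modulus p`_j <= 2 ^+ k * root_measure p.

(** The half of the claim reached by differentiation: nonzero constant term and exponent at least
    half the degree. *)
Definition upper_coef_bound k := forall s p, (size s <= k.+2)%N ->
  (forall i, p`_i != 0 -> i \in s) -> p`_0 != 0 ->
  forall j, (0 < j)%N -> ((size p).-1 <= j.*2)%N -> modulus p`_j <= 2 ^+ k * root_measure p.

(** An exponent strictly between 0 and the degree would force three distinct entries into a list of
    length two. *)
Lemma upper_coef_bound0 : upper_coef_bound 0.
Proof.
move=> s p s2 sp p0 j j0 nj; rewrite mul1r.
have [->|pj] := eqVneq p`_j 0; first by rewrite modulus0 root_measure_ge0.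
have pN0 : p != 0 by apply: contraNneq p0 => ->; rewrite coef0.
have [<-|jn] := eqVneq (size p).-1 j; first exact: modulus_lead_coef_le.
have n0 : (0 < (size p).-1)%N.
  rewrite lt0n; apply: contraNneq pj => n0.
  by rewrite nth_default// (leq_trans (leqSpred _))// n0.
have : (size [:: 0%N; j; (size p).-1] <= size s)%N.
  apply: uniq_leq_size => [|i].
    by rewrite /= !inE !negb_or andbT !(eq_sym 0%N) (eq_sym j _.-1) -!lt0n j0 n0 jn.
  rewrite !inE => /or3P[] /eqP ->; apply: sp => //.
  by rewrite -/(lead_coef p) lead_coef_eq0.
by move=> /leq_trans/(_ s2).
Qed.

Lemma upper_coef_boundS k : coef_bound k -> upper_coef_bound k.+1.
Proof.
move=> IH s p sk sp p0 j j0 nj.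
have s0 : 0%N \in s by exact: sp.
have : modulus (deriv p)`_j.-1 <= 2 ^+ k * root_measure (deriv p).
  (* Dropping the exponent 0 shortens the list by one. *)
  apply: (IH [seq i.-1 | i <- rem 0%N s]) => [|i].
    by rewrite size_map size_rem// -ltnS (leq_trans _ sk)// prednK//; case: (s) s0.
  rewrite coef_deriv => pi.
  have {}pi : p`_i.+1 != 0 by apply: contraNneq pi => ->; rewrite mul0rn.
  by apply/mapP; exists i.+1 => //; exact/rem_mem/sp.
rewrite coef_deriv prednK//.
rewrite -[_ *+ j]mulr_natl modulusM modulus_nat => bound.
have jR : 0 < j%:R :> R by rewrite ltr0n.
rewrite -(ler_pM2l jR) (le_trans bound)//.
(* Mahler's inequality costs the degree, which is at most 2j; the factor j cancels against the one
   from differentiation. *)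
apply: (@le_trans _ _ (2 ^+ k * ((size p).-1%:R * root_measure p))); last first.
  have -> : j%:R * (2 ^+ k.+1 * root_measure p) = 2 ^+ k * (2 * j%:R * root_measure p) by rewrite exprS; ring.
  by rewrite ler_wpM2l ?exprn_ge0// ler_wpM2r ?root_measure_ge0// -natrM ler_nat mul2n.
by rewrite ler_wpM2l ?exprn_ge0// root_measure_deriv.
Qed.

Lemma coef_bound_upper k : upper_coef_bound k -> coef_bound k.
Proof.
(* The induction on the size serves to divide out X while the constant term is zero. *)
move=> ub s p; have [m] := ubnP (size p); elim: m s p => // m IH s p pm sk sp j.
have [->|pj] := eqVneq p`_j 0.
  by rewrite modulus0 mulr_ge0 ?exprn_ge0 ?root_measure_ge0.
have pN0 : p != 0 by apply: contraNneq pj => ->; rewrite coef0.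
have [p0|p0] := eqVneq p`_0 0.
  pose q := \poly_(i < size p) p`_i.+1.
  have qE i : q`_i = p`_i.+1.
    by rewrite coef_poly; case: ltnP => // h; rewrite nth_default// ltnW.
  have pE : p = 'X * q.
    by apply/polyP => -[|i]; rewrite mulrC coefMX.
  have qN0 : q != 0 by apply: contraNneq pN0 => q0; rewrite pE q0 mulr0.
  case: j pj => [|j] pj; first by rewrite p0 eqxx in pj.
  rewrite -qE pE root_measure_mulX; apply: (IH [seq i.-1 | i <- s]).
  - by move: pm; rewrite pE mulrC size_mulX.
  - by rewrite size_map.
  - by move=> i; rewrite qE => /sp si; apply/mapP; exists i.+1.
have [->|j0] := posnP j.
  rewrite (le_trans (modulus_coef0_le _))// ler_peMl ?root_measure_ge0//.
  by rewrite exprn_ege1// ler1n.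
have [nj|jn] := leqP (size p).-1 j.*2; first exact: (ub s).
(* Now 2j < n, so the coefficient sits at n - j > n/2 in the reversed polynomial, which still has
   degree n because p(0) is nonzero. *)
set n := (size p).-1 in jn *.
have sizep : size p = n.+1 by rewrite prednK// size_poly_gt0.
have jlen : (j <= n)%N by rewrite -ltnS -sizep ltnNge; apply: contraNN pj => ?; rewrite nth_default.
have nj0 : (0 < n - j)%N by lia.
have sr : size (rev_poly n p) = n.+1.
  by rewrite size_poly_eq// subnn.
have -> : p`_j = (rev_poly n p)`_(n - j) by rewrite coef_rev_poly leq_subr subKn.
rewrite -(root_measure_rev _ p0) -/n; apply: (ub [seq (n - i)%N | i <- s]) => //.
- by rewrite size_map.
- move=> i; rewrite coef_rev_poly; case: leqP => [ni|]; last by rewrite eqxx.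
  by move=> /sp si; apply/mapP; exists (n - i)%N; rewrite ?subKn.
- by rewrite coef_rev_poly subn0 -/(lead_coef p) lead_coef_eq0.
- by rewrite sr /=; lia.
Qed.

Lemma coef_le_root_measure k : coef_bound k.
Proof.
by elim: k => [|k IH]; apply: coef_bound_upper;
  [exact: upper_coef_bound0|exact: upper_coef_boundS].
Qed.

End SparseCoefficients.

Theorem theorem1 (R : realType) (k : nat) (hk : (2 <= k)%N)
    (n : nat -> nat) (a : nat -> R[i])
    (hn : forall i j : nat, (1 <= i)%N -> (i < j)%N -> (j < k)%N -> (n j < n i)%N)
    (hn0 : forall i : nat, (1 <= i)%N -> (i < k)%N -> (0 < n i)%N)
    (f : {poly R[i]})
    (hf : f = \sum_(1 <= i < k) a i *: 'X^(n i) + (a k)%:P)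
    (hf0 : f != 0) :
  height f / 2 ^+ (k - 2) <= mahler f.
Proof.
apply: le_trans (root_measure_le_mahler f hf0); rewrite ler_pdivrMr ?exprn_gt0// mulrC.
apply: bigmax_le => [|j _]; first by rewrite mulr_ge0 ?exprn_ge0 ?root_measure_ge0.
(* The exponent 0 together with the k - 1 values of [n] gives k = (k - 2) + 2 entries. *)
apply: (@coef_le_root_measure R (k - 2) (0%N :: [seq n i | i <- index_iota 1 k])).
  by rewrite /= size_map size_iota; lia.
move=> i; apply: contraNT; rewrite inE negb_or => /andP[i0 ni].
rewrite hf coefD coefC (negPf i0) addr0 coef_sum big_seq big1// => l lk.
rewrite coefZ coefXn; case: eqP => [il|]; last by rewrite mulr0.
by case/negP: ni; apply/mapP; exists l.
Qed.
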